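(* Let $f_{0,\infty}=(f_0,f_1,\ldots)$ be a sequence of continuous self-maps of $I=[0,1]$ converging uniformly to a continuous map $f\colon I\to I$. If $f$ is nonchaotic stable, then $f_{0,\infty}$ is nonchaotic with respect to small random perturbations.
   Context: $\mathrm{Per}(f)$ denotes the set of periodic points of $f$ ($p$ with $f^n(p)=p$ for some $n\in\mathbb{N}$). $f$ is nonchaotic stable if for each $\varepsilon>0$ there exists $\delta>0$ such that for every continuous $g\colon I\to I$ with $\sup_{x\in I}|f(x)-g(x)|<\delta$ and every $x\in I$ there is a periodic point $p$ of $g$ with $\limsup_{n\to\infty}|g^n(x)-g^n(p)|<\varepsilon$. For a sequence $g_{0,\infty}$ and $k\in\mathbb{N}_0$, $g_{k,\infty}=(g_k,g_{k+1},\ldots)$. Each map $g$ in the sequence is extended continuously to $\mathbb{R}$ so that $g(\mathbb{R}\setminus I)\subseteq g(\{0,1\})$. Fix a probability space $(\Omega,\Sigma,P)$. For $\delta>0$, a $(g_{0,\infty},\delta)$-process beginning at $x_0$ is given by $X_0=x_0$, $X_{n+1}=g_n(X_n)+\xi_n$, where $\xi_0,\xi_1,\ldots$ are independent with uniform continuous distribution on $[-\delta,\delta]$. A sequence $f_{0,\infty}$ converging uniformly to $f$ is nonchaotic with respect to small random perturbations if for each $\varepsilon>0$ there exist $K\in\mathbb{N}$ and $\delta>0$ such that for each integer $k>K$, each $\delta'\in(0,\delta)$ and each $x_0\in I$, $P\big(\exists p\in\mathrm{Per}(f)\colon \limsup_{n\to\infty}|X_n-f^n(p)|<\varepsilon\big)=1$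 for every $(f_{k,\infty},\delta')$-process $(X_n)$ beginning at $x_0$. *)

(* Defs.v *)
From HB Require Import structures.
From mathcomp Require Import all_boot all_order all_algebra.
From mathcomp Require Import all_classical all_reals all_analysis.
Set Implicit Arguments. Unset Strict Implicit. Unset Printing Implicit Defensive.
Import Order.TTheory GRing.Theory Num.Theory numFieldNormedType.Exports.
Local Open Scope classical_set_scope.
Local Open Scope ring_scope.

Section Defs.
Variable R : realType.

Definition I01 : set R := `[0, 1].

(* g : R -> R represents a continuous self-map of I (only its values on I
   matter). *)
Definition cont_self_map (g : R -> R) : Prop :=
  (forall x, I01 x -> I01 (g x)) /\ {within I01, continuous g}.

Definition sup_dist (f g : R -> R) : R :=
  sup [set `|f x - g x| | x in I01].

Definition Per (g : R -> R) : set R :=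
  [set p | I01 p /\ exists n : nat, (0 < n)%N /\ iter n g p = p].

Definition limsupR (u : nat -> R) : \bar R := limn_esup (fun n => (u n)%:E).

Definition nonchaotic_stable (f : R -> R) : Prop :=
  forall eps : R, 0 < eps -> exists delta : R, 0 < delta /\
    forall g : R -> R, cont_self_map g -> sup_dist f g < delta ->
    forall x, I01 x ->
      exists p, Per g p /\
        (limsupR (fun n => `|iter n g x - iter n g p|%R) < eps%:E)%E.

Definition unif_conv_I (fs : nat -> R -> R) (f : R -> R) : Prop :=
  forall e : R, 0 < e -> exists N : nat, forall n, (N <= n)%N ->
    forall x, I01 x -> `|fs n x - f x| < e.

(* The unique continuous extension of a map on I to R with
   g(R \ I) included in g({0,1}): g composed with the clamp onto [0,1]. *)
Definition clamp01 (x : R) : R := Num.min (Num.max x 0) 1.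
Definition extend (g : R -> R) : R -> R := fun x => g (clamp01 x).

End Defs.

Section Prob.
Context {d : measure_display} {Omega : measurableType d} {R : realType}.

Definition mutually_independent (P : probability Omega R)
    (xi : nat -> Omega -> R) : Prop :=
  (forall n, measurable_fun setT (xi n)) /\
  forall (J : seq nat) (B : nat -> set R), uniq J ->
    (forall j, j \in J -> measurable (B j)) ->
    P (\bigcap_(j in [set j | j \in J]) (xi j @^-1` B j)) =
      (\prod_(j <- J) P (xi j @^-1` B j))%E.

Definition uniform_on (P : probability Omega R) (X : Omega -> R) (a b : R)
  : Prop :=
  forall B : set R, measurable B ->
    P (X @^-1` B) = (((b - a)^-1)%:E * (@lebesgue_measure R) (B `&` `[a, b]))%E.

Definition noise (P : probability Omega R) (delta : R) (xi : nat -> Omega -> R)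
  : Prop :=
  mutually_independent P xi /\ forall n, uniform_on P (xi n) (- delta) delta.

Fixpoint process (g : nat -> R -> R) (xi : nat -> Omega -> R) (x0 : R)
    (n : nat) (w : Omega) : R :=
  match n with
  | 0 => x0
  | n'.+1 => extend (g n') (process g xi x0 n' w) + xi n' w
  end.

(* f_{0,oo} (converging uniformly to f) is nonchaotic with respect to small
   random perturbations, on the probability space (Omega, P).  The event
   "P(...) = 1" is read as "almost surely" (the event holds outside a
   P-null measurable set). *)
Definition nonchaotic_random (P : probability Omega R)
    (fs : nat -> R -> R) (f : R -> R) : Prop :=
  forall eps : R, 0 < eps -> exists (K : nat) (delta : R), 0 < delta /\
    forall k : nat, (K < k)%N ->
    forall delta' : R, 0 < delta' -> delta' < delta ->
    forall x0 : R, I01 x0 ->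
    forall xi : nat -> Omega -> R, noise P delta' xi ->
      {ae P, forall w, exists p, Per f p /\
         (limsupR (fun n => `|process (fun m => fs (k + m)%N) xi x0 n w
                               - iter n f p|%R) < eps%:E)%E}.

End Prob.

(* Main.v *)
Require Import Defs.
From HB Require Import structures.
From mathcomp Require Import all_boot all_order all_algebra.
From mathcomp Require Import all_classical all_reals all_analysis.
From mathcomp Require Import ring lra zify.
Set Implicit Arguments. Unset Strict Implicit. Unset Printing Implicit Defensive.
Import Order.TTheory GRing.Theory Num.Theory numFieldNormedType.Exports.
Local Open Scope classical_set_scope.
Local Open Scope ring_scope.

(* The argument is pathwise: almost surely |xi_n| <= delta' for all n, and then
   the process clamped to I is an e-chain of f, with e small.  Such a chain
   accumulates at a point close to a chain recurrent point a of f (compactness),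
   and it can be joined to a and back by eta-chains; so can the true orbit of a.
   Stability makes all eta-chains that start at a and can return to a stay
   together: two eta-loops of the same length at a that separate at some time
   would produce, after a small perturbation of f, a horseshoe, hence an orbit
   switching aperiodically between the two loops, against stability.  Therefore
   the process is close to the orbit of a, which by stability of f itself is close
   to a periodic orbit of f. *)

(** * The unit interval: compactness, clamping and eventual bounds from a limsup *)

Section UnitInterval.
Variable R : realType.
Implicit Types (x y z e : R) (u : nat -> R).

Lemma I01E x : I01 x <-> 0 <= x <= 1.
Proof. by rewrite /I01 /= in_itv. Qed.

Lemma I01_cluster u : (forall n, I01 (u n)) ->
  exists2 a, I01 a & forall e, 0 < e -> forall n,
    exists2 m, (n <= m)%N & `|u m - a| < e.
Proof.
move=> uI.
have [|a [aI ca]] := @segment_compact R 0 1 (u @ \oo) _.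
  by exists 0%N => // n _; exact: uI.
exists a => // e e0 n.
have e20 : 0 < e / 2 by lra.
have [p np pe] := (cluster_eventuallyP u a).1 ca (e / 2) n e20.
by exists p => //; rewrite distrC; lra.
Qed.

Lemma clamp01_itv x : I01 (clamp01 x).
Proof.
by apply/I01E; rewrite /clamp01 le_min ge_min lexx orbT andbT le_max lexx orbT ler01.
Qed.

Lemma clamp01_id x : I01 x -> clamp01 x = x.
Proof. by move=> /I01E /andP[x0 x1]; rewrite /clamp01 (max_idPl x0) (min_idPl x1). Qed.

Lemma clamp01_lip x y : `|clamp01 x - clamp01 y| <= `|x - y|.
Proof.
rewrite /clamp01 !minEle !maxEle.
by repeat case: ifPn; rewrite -?ltNge => *; rewrite ler_norml; case: (ler0P (x - y)); lra.
Qed.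

Lemma clamp01_continuous : continuous (@clamp01 R).
Proof.
move=> x; apply/cvgrPdist_lt => e e0; near=> y.
apply: le_lt_trans (clamp01_lip _ _) _.
by near: y; apply/nbhs_ballP; exists e.
Unshelve. all: by end_near. Qed.

Lemma extend_continuous (f : R -> R) :
  {within (@I01 R), continuous f} -> continuous (extend f).
Proof.
move=> /subspace_continuousP cf x; apply/cvgrPdist_lt => e e0.
have /cvgrPdist_lt/(_ _ e0) := cf _ (clamp01_itv x).
rewrite near_withinE => H.
have Hx : \forall y \near x, I01 (clamp01 y) -> `|f (clamp01 x) - f (clamp01 y)| < e.
  have hc := @clamp01_continuous x. exact: (hc _ H).
near=> y; apply: (near Hx y) => //; exact: clamp01_itv.
Unshelve. all: by end_near. Qed.

Lemma unif_continuous_I01 (F : R -> R) : continuous F ->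
  forall e, 0 < e -> exists2 r, 0 < r &
    forall x y, I01 x -> I01 y -> `|x - y| < r -> `|F x - F y| < e.
Proof.
move=> cF e e0; apply: contrapT => H.
have /choice[w Hw] : forall n : nat, exists w : R * R,
  [/\ I01 w.1, I01 w.2, `|w.1 - w.2| < n.+1%:R^-1 & e <= `|F w.1 - F w.2|].
  move=> n; apply: contrapT => Hn; apply: H; exists n.+1%:R^-1; first by rewrite invr_gt0.
  move=> x y xI yI xy; rewrite ltNge; apply/negP => Fxy.
  by apply: Hn; exists (x, y).
have [|a aI ca] := @I01_cluster (fun n => (w n).1); first by move=> n; case: (Hw n).
have e20 : 0 < e / 2 by lra.
have /cvgrPdist_lt/(_ _ e20)/nbhs_ballP[r /= r0 Hr] := cF a.
have r20 : 0 < r / 2 by rewrite divr_gt0.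
have [N _ HN] := near_infty_natSinv_lt (PosNum r20).
have [m Nm wma] := ca _ r20 N.
have [_ _ w12 Fe] := Hw m.
have {}w12 := lt_trans w12 (HN m Nm); rewrite /= in w12.
have h1 : `|F a - F (w m).1| < e / 2 by apply: Hr; rewrite /ball /= distrC; lra.
have h2 : `|F a - F (w m).2| < e / 2.
  apply: Hr; rewrite /ball /= distrC.
  have := ler_distD (w m).1 (w m).2 a; rewrite (distrC (w m).2 (w m).1); lra.
have := ler_distD (F a) (F (w m).1) (F (w m).2); rewrite (distrC (F (w m).1) (F a)); lra.
Qed.

Lemma limsupR_lt_near u e : (limsupR u < e%:E)%E ->
  exists N, forall n, (N <= n)%N -> u n < e.
Proof.
rewrite /limsupR /limn_esup limf_esupE => /ereal_inf_lt[_ [A [N _ NA] <-] Ae].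
exists N => n Nn; rewrite -lte_fin; apply: le_lt_trans Ae.
by apply: ereal_sup_ubound; exists n => //; exact: NA.
Qed.

Lemma limsupR_le u e N : (forall n, (N <= n)%N -> u n <= e) ->
  (limsupR u <= e%:E)%E.
Proof.
move=> ue; rewrite /limsupR /limn_esup limf_esupE.
apply: (@le_trans _ _ (ereal_sup [set (u n)%:E | n in [set k | (N <= k)%N]])).
  by apply: ereal_inf_lbound; exists [set k | (N <= k)%N] => //; exists N.
by apply: ge_ereal_sup => _ [n Nn <-]; rewrite lee_fin ue.
Qed.
End UnitInterval.

(** * Separating finitely many points, patching a map near them, and coded series *)

Section Perturbation.
Variable R : realType.

Lemma finite_pos_lower_bound (A : finType) (phi : A -> R) :
  (forall i, 0 < phi i) -> exists2 s, 0 < s & forall i, s <= phi i.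
Proof.
move=> phi0; exists (\big[Order.min/1]_i phi i); last by move=> i; exact: bigmin_inf.
by elim/big_ind: _ => // x y x0 y0; rewrite lt_min x0.
Qed.

(* The new points [(k_i + q_i) / M.+1], with [k_i] the integer part of [M * v i],
   are distinct because their fractional parts [q_i] after scaling are. *)
Lemma perturb_injective (A : finType) (v : A -> R) (r : R) :
  (forall i, I01 (v i)) -> 0 < r ->
  exists v' : A -> R, [/\ injective v', forall i, 0 < v' i < 1 &
    forall i, `|v' i - v i| < r].
Proof.
move=> vI r0.
pose M := (Num.truncn (2 / r)).+1; pose n := #|{: A}|.
pose k i := Num.truncn (M%:R * v i).
(* The remainder [(enum_rank i).+1] is never 0, and the denominator [M.+1] exceeds every [k i + q];
   hence the new points avoid both 0 and 1. Each moves by at most [2 / M.+1], which the choice of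
   [M] puts below [r]. *)
pose N (i : A) := (k i * n.+1 + (enum_rank i).+1)%N.
have rM : 2 < r * M%:R.
  have /truncn_itv/andP[_] : 0 <= 2 / r by rewrite divr_ge0// ltW.
  by rewrite ltr_pdivrMr// mulrC.
have M0 : (0 : R) < M%:R by rewrite ltr0n.
have n0 : (0 : R) < n.+1%:R by rewrite ltr0n.
have M10 : (0 : R) < M.+1%:R by rewrite ltr0n.
have rk (i : A) : ((enum_rank i).+1 < n.+1)%N by rewrite ltnS; exact: ltn_ord.
have kP i : (k i)%:R <= M%:R * v i < (k i)%:R + 1.
  rewrite natr1; apply: truncn_itv.
  by have /I01E/andP[? _] := vI i; rewrite mulr_ge0.
have NE i : exists2 q : R, 0 < q < 1 & (N i)%:R / (M.+1 * n.+1)%:R = ((k i)%:R + q) / M.+1%:R.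
  exists ((enum_rank i).+1%:R / n.+1%:R).
    by rewrite divr_gt0 ?ltr0n//= ltr_pdivrMr// mul1r ltr_nat.
  rewrite /N natrD !natrM; field; lra.
exists (fun i => (N i)%:R / (M.+1 * n.+1)%:R); split.
- move=> i j /= /divIf; rewrite pnatr_eq0 => /(_ isT) /eqP; rewrite eqr_nat => /eqP.
  move=> /(congr1 (modn^~ n.+1)); rewrite /N !modnMDl !modn_small//.
  by move=> [/val_inj/enum_rank_inj].
- move=> i; have [q /andP[q0 q1] ->] := NE i.
  have /andP[h1 h2] := kP i; have /I01E/andP[v0 v1] := vI i.
  have k0 : (0 : R) <= (k i)%:R by [].
  have : M%:R * v i <= M%:R by rewrite ler_piMr.
  rewrite divr_gt0//=; last lra.
  by rewrite ltr_pdivrMr// mul1r -natr1; lra.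
- move=> i; have [q /andP[q0 q1] ->] := NE i.
  have /andP[h1 h2] := kP i; have /I01E/andP[v0 v1] := vI i.
  have -> : ((k i)%:R + q) / M.+1%:R - v i = ((k i)%:R + q - M%:R * v i - v i) / M.+1%:R.
    by rewrite -natr1; field; rewrite natr1; lra.
  rewrite normrM normfV (gtr0_norm M10) ltr_pdivrMr// -natr1.
  have : `|(k i)%:R + q - M%:R * v i - v i| <= 2 by rewrite ler_norml; lra.
  lra.
Qed.

(** Add to [F] the differences [h i - F], each weighted by a bump that is 1 within [s] of [v i] and
    0 beyond [2 * s]. The separation leaves at most one nonzero bump at any point, so the error is
    at most that of a single [h i]. The final clamp does not increase it, because [F] takes values
    in I. *)
Lemma patch_local_maps (A : finType) (F : R -> R) (v : A -> R) (h : A -> R -> R) (s e : R) :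
  continuous F -> (forall x, I01 (F x)) -> (forall i, continuous (h i)) ->
  0 < s -> 0 <= e ->
  (forall i j, i != j -> 4 * s <= `|v i - v j|) ->
  (forall i y, `|y - v i| < 2 * s -> `|h i y - F y| <= e) ->
  exists g : R -> R, [/\ continuous g, forall x, I01 (g x),
    forall x, `|F x - g x| <= e &
    forall i y, `|y - v i| <= s -> I01 (h i y) -> g y = h i y].
Proof.
move=> cF FI ch s0 e0 vs he.
pose t i y := clamp01 (2 - `|y - v i| / s).
have clamp0 (x : R) : x <= 0 -> clamp01 x = 0.
  by move=> x0; rewrite /clamp01 (max_idPr x0) (min_idPl ler01).
have clamp1 (x : R) : 1 <= x -> clamp01 x = 1.
  by move=> x1; apply/min_idPr; rewrite le_max x1.
pose w y := F y + \sum_i t i y * (h i y - F y).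
have far i j y : i != j -> `|y - v i| < 2 * s -> t j y = 0.
  move=> ij yi; apply: clamp0; rewrite subr_le0 ler_pdivlMr//.
  have := ler_distD y (v i) (v j); have := vs _ _ ij; rewrite (distrC (v i) y); lra.
have out i y : 2 * s <= `|y - v i| -> t i y = 0.
  by move=> yi; apply: clamp0; rewrite subr_le0 ler_pdivlMr.
have wE i y : `|y - v i| < 2 * s -> w y = F y + t i y * (h i y - F y).
  move=> yi; rewrite /w (bigD1 i)//= big1 ?addr0// => j ji.
  by rewrite (far i j) ?mul0r// eq_sym.
have t01 i y : 0 <= t i y <= 1.
  by apply/I01E; exact: clamp01_itv.
have wF y : `|F y - w y| <= e.
  have [[i yi]|H] := pselect (exists i, `|y - v i| < 2 * s).
    rewrite (wE i)// opprD addrA subrr sub0r normrN normrM.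
    have /andP[a b] := t01 i y; rewrite ger0_norm//.
    by apply: le_trans (he i y yi); rewrite ler_piMl.
  rewrite /w big1 ?addr0 ?subrr ?normr0// => i _.
  rewrite out ?mul0r// leNgt; apply/negP => yi; apply: H; by exists i.
exists (@clamp01 R \o w); split => /=.
- move=> y; apply: continuous_comp; last exact: (@clamp01_continuous R).
  apply: cvgD; first exact: cF.
  apply: continuous_big; first exact: add_continuous.
  move=> i _ {}y; apply: cvgM; last by apply: cvgB; [exact: ch|exact: cF].
  apply: (@continuous_comp _ _ _ (fun y => 2 - `|y - v i| / s) (@clamp01 R));
    last exact: clamp01_continuous.
  apply: cvgB; first exact: cvg_cst.
  apply: cvgMl; apply: cvg_norm; apply: cvgB; [exact: cvg_id|exact: cvg_cst].
- by move=> x; exact: clamp01_itv.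
- by move=> x; apply: le_trans (wF x); rewrite -{1}(clamp01_id (FI x)) clamp01_lip.
- move=> i y yi hI; rewrite (wE i); last lra.
  suff -> : t i y = 1 by rewrite mul1r addrC subrK clamp01_id.
  apply: clamp1; have : `|y - v i| / s <= 1 by rewrite ler_pdivrMr// mul1r.
  lra.
Qed.

(* [z k] is the sum of the series [s (k + j) / M ^ (j + 1)] over [j]. *)
Lemma coded_offsets (s : nat -> bool) (M : R) : 1 < M ->
  exists z : nat -> R, forall k,
    [/\ 0 <= z k, z k <= (M - 1)^-1 & M * z k = (s k)%:R + z k.+1].
Proof.
move=> M1.
pose P := fix P n (k : nat) : R := if n is n'.+1 then ((s k)%:R + P n' k.+1) / M else 0.
have M0 : 0 < M by lra.
have P0 n k : 0 <= P n k.
  by elim: n k => //= n IH k; rewrite divr_ge0 ?addr_ge0// ltW.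
(* The bound is the fixed point of [t -> (1 + t) / M], the recursion with the larger symbol. *)
have P1 n k : P n k <= (M - 1)^-1.
  elim: n k => [k|n IH k] /=; first by rewrite invr_ge0; lra.
  rewrite ler_pdivrMr//; have -> : (M - 1)^-1 * M = 1 + (M - 1)^-1 by field; lra.
  by rewrite lerD//; case: (s k); rewrite ?ler01.
have PS n k : P n k <= P n.+1 k.
  elim: n k => [k|n IH k]; first exact: P0.
  by rewrite /= ler_pM2r ?invr_gt0// lerD2l; exact: IH.
have cP k : cvgn (P^~ k).
  apply: nondecreasing_is_cvgn; first by apply/nondecreasing_seqP => n; exact: PS.
  by exists (M - 1)^-1 => _ [n _ <-].
exists (fun k => limn (P^~ k)) => k; split.
- by apply: limr_ge; [exact: cP|apply: nearW => n].
- by apply: limr_le; [exact: cP|apply: nearW => n].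
- have h1 : (fun n => P n.+1 k) @ \oo --> limn (P^~ k).
    by rewrite (cvg_shiftS (P^~ k)); exact: cP.
  have h2 : (fun n => P n.+1 k) @ \oo --> ((s k)%:R + limn (P^~ k.+1)) / M.
    by apply: cvgMl; apply: cvgD; [exact: cvg_cst|exact: cP].
  rewrite (cvg_unique (@Rhausdorff R) h1 h2); field; lra.
Qed.
End Perturbation.

(** * The squares as a set of times that is not eventually periodic *)

Definition is_square (k : nat) : bool := [exists m : 'I_k.+1, (m * m == k)%N].

Lemma is_squareP k : reflect (exists m, m * m = k)%N (is_square k).
Proof.
apply: (iffP existsP) => [[m /eqP mk]|[m mk]]; first by exists m.
have mk1 : (m < k.+1)%N by nia.
by exists (Ordinal mk1); apply/eqP.
Qed.

(** The next square after [m * m] is [2 * m + 1] further. So each candidate period [T] fails at all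
    large squares. *)
Lemma is_square_add m T : (0 < T <= 2 * m)%N -> ~~ is_square (m * m + T).
Proof.
move=> /andP[T0 Tm]; apply/is_squareP => -[q qE].
have [qm|mq] := leqP q m; first by have := leq_mul qm qm; lia.
by have := leq_mul mq mq; lia.
Qed.

(** * Loops that separate produce horseshoes *)

Section Shadowing.
Variable R : realType.
Variable F : R -> R.
Hypothesis FI : forall x, I01 (F x).
Hypothesis Fc : continuous F.
Hypothesis Fuc : forall e, 0 < e -> exists2 r, 0 < r &
  forall x y, `|x - y| < r -> `|F x - F y| < e.

(** One instance of nonchaotic stability, with the limsup unfolded into an eventual bound and the
    period made explicit, for maps defined on the whole line. *)
Definition stable_at (eps delta : R) := forall g : R -> R,
  continuous g -> (forall x, I01 (g x)) -> (forall x, `|F x - g x| <= delta) ->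
  forall x, I01 x -> exists p T N, [/\ I01 p, (0 < T)%N, iter T g p = p &
    forall n, (N <= n)%N -> `|iter n g x - iter n g p| < eps].

Definition chain (eta : R) (n : nat) (u : nat -> R) :=
  (forall j, I01 (u j)) /\ forall j, (j < n)%N -> `|u j.+1 - F (u j)| < eta.

(** With [r <= e], one radius controls both the displacement of a point and that of its image. *)
Lemma uniform_modulus e : 0 < e -> exists r, [/\ 0 < r, r <= e &
  forall x y, `|x - y| < r -> `|F x - F y| < e].
Proof.
move=> e0; have [r r0 Fr] := Fuc e0; exists (Num.min r e).
by rewrite lt_min r0 e0 ge_min lexx orbT; split=> // x y; rewrite lt_min => /andP[/Fr].
Qed.

(* A node (b, j) stands for the j-th point of the loop b.  The map [g]
   translates a neighbourhood of each node onto one of the next node, except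
   that it expands by [M] around the last node of either loop, so that the image
   there covers the neighbourhoods of both initial nodes.  Hence every sequence
   of loops is followed by some orbit of [g]. *)
Lemma horseshoe (L : nat) (u : bool * 'I_L.+1 -> R) (eta t : R) :
  let U b j := u (b, inord j) in
  0 < eta -> 0 < t -> injective u -> (forall a, 0 < u a < 1) ->
  (forall b j, (j < L)%N -> `|U b j.+1 - F (U b j)| <= 3 * eta) ->
  (forall b b', `|U b' 0%N - F (U b L)| <= 3 * eta) ->
  `|U true 0%N - U false 0%N| <= 2 * eta ->
  exists (g : R -> R) (x : nat -> R), [/\ continuous g, forall y, I01 (g y),
    forall y, `|F y - g y| <= 9 * eta &
    forall n, [/\ I01 (x n), g (x n) = x n.+1 &
      `|x n - U (is_square (n %/ L.+1)%N) (n %% L.+1)%N| <= t]].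
Proof.
move=> U eta0 t0 u_inj u01 UF UF0; set D := U true 0%N - U false 0%N => D_le.
have [r [r0 r_eta Fr]] := uniform_modulus eta0.
have D_neq0 : D != 0 by rewrite subr_eq0; apply/eqP => /u_inj.
(* A quarter of each distance, to get the separation [4 * s] needed for patching; the diagonal value
   1 is only a positive filler. *)
pose gap (ab : (bool * 'I_L.+1) * (bool * 'I_L.+1)) :=
  if ab.1 == ab.2 then 1 else `|u ab.1 - u ab.2| / 4.
have gap0 ab : 0 < gap ab.
  rewrite /gap; have [//|ab'] := eqVneq ab.1 ab.2.
  by rewrite divr_gt0// normr_gt0 subr_eq0 (inj_eq u_inj).
have [s1 s10 s1u] := finite_pos_lower_bound gap0.
have mgn0 a : 0 < Num.min (u a) (1 - u a).
  by have /andP[? ?] := u01 a; rewrite lt_min; apply/andP; split; lra.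
have [s2 s20 s2u] := finite_pos_lower_bound mgn0.
have [s [s0 ss1 ss2 s_r s_t]] : exists s, [/\ 0 < s, s <= s1, s <= s2, s <= r / 2 & s <= t].
  exists (Num.min (Num.min s1 s2) (Num.min (r / 2) t)).
  by rewrite !lt_min s10 s20 t0 divr_gt0// !ge_min !lexx !orbT.
(* Chosen so that |D| / (M - 1) = s: the coded offsets, scaled by [D], then stay within [s] of the
   nodes. *)
pose M := 1 + `|D| / s.
have Ds0 : 0 < `|D| / s by rewrite divr_gt0// normr_gt0.
have MsE : M * s = s + `|D| by rewrite /M; field; lra.
have M1 : 1 < M by rewrite /M; lra.
pose h (a : bool * 'I_L.+1) y := if (a.2 < L)%N then y - u a + U a.1 a.2.+1
  else M * (y - u a) + U false 0%N.
have uE a : u a = U a.1 a.2 by case: a => b j; rewrite /U inord_val.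
have [||||g [gc gI gF gE]] := @patch_local_maps R _ F u h s (9 * eta) Fc FI _ s0.
- move=> a; rewrite /h; case: (a.2 < L)%N => x.
    by apply: cvgD; [apply: cvgB|]; [exact: cvg_id|exact: cvg_cst|exact: cvg_cst].
  apply: cvgD; [apply: cvgMr; apply: cvgB|]; [exact: cvg_id|exact: cvg_cst|exact: cvg_cst].
- lra.
- move=> a a' aa'; have := s1u (a, a'); rewrite /gap /= (negbTE aa'); lra.
- move=> a y ya; have h1 : `|F (u a) - F y| < eta by apply: Fr; rewrite distrC; lra.
  have := ler_distD (F (u a)) (h a y) (F y).
  (* At a last node the jump costs [3 * eta] and the expansion 2 M s = 2 s + 2 |D|, at most
     [eta + 4 * eta]. At other nodes the translation adds only [2 * s]. *)
  suff : `|h a y - F (u a)| <= 8 * eta by lra.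
  rewrite /h; case: ifPn => aL.
    have h2 := UF a.1 _ aL; rewrite -uE in h2.
    rewrite -addrA; apply: le_trans (ler_normD _ _) _; lra.
  have aE : a.2 = L :> nat by apply/eqP; rewrite eqn_leq -ltnS ltn_ord leqNgt.
  have h2 := UF0 a.1 false; rewrite (_ : U a.1 L = u a) in h2; last by rewrite uE aE.
  rewrite -addrA; apply: le_trans (ler_normD _ _) _.
  rewrite normrM (gtr0_norm (_ : 0 < M)); last lra.
  have : M * `|y - u a| <= M * (2 * s) by rewrite ler_pM2l; lra.
  have -> : M * (2 * s) = 2 * (M * s) by ring.
  rewrite MsE; lra.
have [z zP] := @coded_offsets R is_square M M1.
(* The offset in block [k] codes the symbols from [k.+1] on. Multiplying it by [M] releases the next
   symbol: the image of the last node is shifted by [D] exactly when the next loop is [true]. *)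
pose Z k := D * z k.+1.
have Zs k : `|Z k| <= s.
  have [z0 z1 _] := zP k.+1; rewrite normrM (ger0_norm z0).
  apply: le_trans (ler_wpM2l (normr_ge0 D) z1) _.
  have -> : M - 1 = `|D| / s by rewrite /M; ring.
  by rewrite invf_div mulrC divfK// normr_eq0.
have ZE k : M * Z k = D * (is_square k.+1)%:R + Z k.+1.
  by have [_ _ zE] := zP k.+1; rewrite /Z mulrCA zE mulrDr.
pose x n := U (is_square (n %/ L.+1)%N) (n %% L.+1)%N + Z (n %/ L.+1)%N.
have xI n : I01 (x n).
  have := s2u (is_square (n %/ L.+1)%N, inord (n %% L.+1)%N); rewrite le_min => /andP[h1 h2].
  have := Zs (n %/ L.+1)%N; rewrite ler_norml => /andP[h3 h4].
  by apply/I01E; rewrite /x /U; apply/andP; split; lra.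
have xS n : g (x n) = x n.+1.
  pose k := (n %/ L.+1)%N; pose b := is_square k.
  pose j := (n %% L.+1)%N; have jL : (j < L.+1)%N by rewrite ltn_mod.
  have jE : @inord L j = j :> nat by rewrite inordK.
  have dn : x n - u (b, inord j) = Z k by rewrite /x -/k -/b -/j /U; ring.
  have hE : h (b, inord j) (x n) = x n.+1.
    rewrite /h dn /= jE; case: ifPn => jL'.
      have [kE jE'] : (n.+1 %/ L.+1 = k /\ n.+1 %% L.+1 = j.+1)%N.
        have := divn_eq n L.+1; rewrite -/k -/j => ->.
        rewrite -addnS divnMDl// modnMDl divn_small ?modn_small ?addn0//.
      rewrite /x kE jE' -/b; ring.
    have jE' : j = L by apply/eqP; rewrite eqn_leq -ltnS jL leqNgt.
    have [kE jE''] : (n.+1 %/ L.+1 = k.+1 /\ n.+1 %% L.+1 = 0)%N.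
      have := divn_eq n L.+1; rewrite -/k -/j jE' => ->.
      by rewrite -addnS -mulSnr mulnK// modnMl.
    rewrite /x kE jE'' ZE /D; case: (is_square _); rewrite /=; ring.
  by rewrite -hE; apply: gE; rewrite ?dn ?Zs// hE.
exists g, x; split=> // n; split=> //.
by rewrite /x addrC addKr; apply: le_trans (Zs _) s_t.
Qed.

(* Otherwise some orbit of a map near [F] would follow the loop [d] at the square
   times and [c] at the others, which no periodic orbit can match. *)
Lemma loops_close eps delta : 0 < eps -> 0 < delta -> stable_at eps delta ->
  exists2 eta, 0 < eta & forall L c d, chain eta L c -> chain eta L d ->
    c 0%N = c L -> d 0%N = c 0%N -> d L = c 0%N ->
    forall i, (i < L)%N -> `|c i - d i| < 4 * eps.
Proof.
move=> eps0 delta0 st.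
(* The horseshoe map is [9 * eta]-close to [F]. At the end, four errors of at most [eta] (two from
   moving the nodes, two from the orbit around them) and two errors of [eps] must add up to at most
   [4 * eps]. *)
pose eta := Num.min (delta / 9) (eps / 2).
have eta0 : 0 < eta by rewrite lt_min; lra.
have eta_delta : eta <= delta / 9 by rewrite ge_min lexx.
have eta_eps : eta <= eps / 2 by rewrite ge_min lexx orbT.
exists eta => // -[//|L] c d [cI cF] [dI dF] cL d0 dL i iL.
have [r [r0 r_eta Fr]] := uniform_modulus eta0.
pose w (b : bool) := if b then d else c.
have wI b j : I01 (w b j) by case: b.
have wF b j : (j < L.+1)%N -> `|w b j.+1 - F (w b j)| < eta by case: b; auto.
have w0 b : w b 0%N = c 0%N by case: b.
have wL b : w b L.+1 = c 0%N by case: b.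
(* The loops share their start and may meet elsewhere, so their points are first moved apart. *)
have [u [u_inj u01 uw]] := @perturb_injective R (bool * 'I_L.+1)%type
  (fun a => w a.1 a.2) r (fun a => wI _ _) r0.
pose U b j := u (b, inord j).
have Uw b j : (j < L.+1)%N -> `|U b j - w b j| < r.
  by move=> jL; have := uw (b, inord j); rewrite /= inordK.
have UF b j : (j < L)%N -> `|U b j.+1 - F (U b j)| < 3 * eta.
  move=> jL; have jL1 : (j < L.+1)%N by exact: ltnW.
  have h1 := Uw b j.+1 jL; have h2 := Fr _ _ (Uw b j jL1); have h3 := wF b j jL1.
  have := ler_distD (w b j.+1) (U b j.+1) (F (U b j)).
  have := ler_distD (F (w b j)) (w b j.+1) (F (U b j)).
  rewrite (distrC (F (w b j))); lra.
have UF0 b b' : `|U b' 0%N - F (U b L)| < 3 * eta.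
  have h1 := Uw b' 0%N isT; have h2 := Fr _ _ (Uw b L (ltnSn _)).
  have h3 := wF b L (ltnSn _); rewrite wL in h3; rewrite w0 in h1.
  have := ler_distD (c 0%N) (U b' 0%N) (F (U b L)).
  have := ler_distD (F (w b L)) (c 0%N) (F (U b L)).
  rewrite (distrC (F (w b L))); lra.
have U0_le : `|U true 0%N - U false 0%N| <= 2 * eta.
  have := Uw true 0%N isT; have := Uw false 0%N isT; rewrite !w0 => h1 h2.
  have := ler_distD (c 0%N) (U true 0%N) (U false 0%N).
  rewrite (distrC (c 0%N)); lra.
have [||g [x [gc gI gF xP]]] := horseshoe eta0 r0 u_inj u01 _ _ U0_le.
- by move=> b j jL; exact/ltW/UF.
- by move=> b b'; exact/ltW/UF0.
have gx n : iter n g (x 0%N) = x n.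
  by elim: n => //= n ->; have [] := xP n.
have xI0 : I01 (x 0%N) by have [] := xP 0%N.
have [y|p [T [N [pI T0 Tp Np]]]] := st g gc gI _ (x 0%N) xI0.
  by apply: le_trans (gF y) _; lra.
(* A late square whose root is large enough that [k + T] is not a square. Blocks [k] and [k + T]
   start a multiple of [T] apart, so the periodic orbit agrees there while the orbit of [x 0]
   follows different loops. *)
pose k := ((N + T) * (N + T))%N.
have kN : (N <= k * L.+1 + i)%N by rewrite /k; clear; nia.
have kN' : (N <= (k + T) * L.+1 + i)%N by move: kN; clear; nia.
have pp : iter ((k + T) * L.+1 + i) g p = iter (k * L.+1 + i) g p.
  have -> : ((k + T) * L.+1 + i = (k * L.+1 + i) + L.+1 * T)%N.
    by rewrite mulnDl addnAC (mulnC T).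
  rewrite iterD; congr (iter _ _ _).
  by elim: L.+1 => //= q IH; rewrite mulSn iterD IH.
have h1 := Np _ kN; have h2 := Np _ kN'; rewrite pp !gx in h1 h2.
have sk : is_square k by apply/is_squareP; exists (N + T)%N.
have skT : is_square (k + T) = false.
  by apply/negbTE/is_square_add; rewrite T0; clear; lia.
have [_ _] := xP (k * L.+1 + i)%N; have [_ _] := xP ((k + T) * L.+1 + i)%N.
rewrite !divnMDl// !modnMDl divn_small// modn_small// !addn0 sk skT.
have := Uw true _ iL; have := Uw false _ iL; rewrite /w -/(U true i) -/(U false i).
move: h1 h2 eta_eps r_eta; clear; rewrite !ltr_norml !ler_norml.
move=> /andP[? ?] /andP[? ?] ? ? /andP[? ?] /andP[? ?] /andP[? ?] /andP[? ?].
by apply/andP; split; lra.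
Qed.

(** * Joining points by chains, chain recurrence, and shadowing by periodic orbits *)

Implicit Types (x y a e eta : R) (u v : nat -> R).

Definition reach eta n x y :=
  exists u, [/\ chain eta n u, u 0%N = x & u n = y].

Lemma iter_I01 n x : I01 x -> I01 (iter n F x).
Proof. by case: n => //= n _; exact: FI. Qed.

Lemma reach_le e e' n x y : e <= e' -> reach e n x y -> reach e' n x y.
Proof.
move=> ee' [u [[uI uF] u0 un]]; exists u; split=> //; split=> // j jn.
exact: lt_le_trans (uF j jn) ee'.
Qed.

Lemma reach_iter eta n x : 0 < eta -> I01 x -> reach eta n x (iter n F x).
Proof.
move=> eta0 xI; exists (fun j => iter j F x); split=> //.
by split=> [j|j _]; [exact: iter_I01|rewrite /= subrr normr0].
Qed.

Lemma reach_trans eta n m x y z :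
  reach eta n x y -> reach eta m y z -> exists u,
    [/\ chain eta (n + m) u, u 0%N = x, u n = y & u (n + m)%N = z].
Proof.
move=> [u [[uI uF] u0 un]] [v [[vI vF] v0 vm]].
exists (fun j => if (j <= n)%N then u j else v (j - n)%N); split=> //.
- split=> [j|j jnm]; first by case: ifP.
  have [jn|jn|jn] := ltngtP j n; first exact: uF.
    by rewrite subSn; [apply: vF; lia|lia].
  by rewrite jn subSnn un -v0; apply: vF; lia.
- by rewrite leqnn.
- case: ifPn => h; last by rewrite addKn.
  have m0 : m = 0%N by lia.
  by rewrite -vm m0 addn0 un v0.
Qed.

(** Only the two end points of the chain are replaced; a step that uses both, as when [n = 1], pays
    [d] twice. *)
Lemma reach_perturb e d n x y x' y' : (0 < n)%N -> 0 < d -> I01 x' -> I01 y' ->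
  `|F x' - F x| < d -> `|y' - y| < d -> reach e n x y -> reach (e + 2 * d) n x' y'.
Proof.
move=> n0 d0 xI yI xd yd [u [[uI uF] u0 un]].
pose w j := if j == 0%N then x' else if (j < n)%N then u j else y'.
exists w; split=> //; last by rewrite /w ltnn gtn_eqF.
split=> [j|j jn]; first by rewrite /w; case: ifP => // _; case: ifP.
have h1 : `|w j.+1 - u j.+1| < d.
  rewrite /w /=; case: ifPn => jn'; first by rewrite subrr normr0.
  have -> : j.+1 = n by lia.
  by rewrite un.
have h2 : `|F (w j) - F (u j)| < d.
  rewrite /w jn; case: eqP => [->|_]; last by rewrite subrr normr0.
  by rewrite u0.
have := ler_distD (u j.+1) (w j.+1) (F (w j)).
have := ler_distD (F (u j)) (u j.+1) (F (w j)).
rewrite (distrC (F (u j))); have := uF j jn; lra.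
Qed.

Lemma chain_repeat eta l u q : (0 < l)%N -> chain eta l u -> u 0%N = u l ->
  chain eta q (fun j => u (j %% l)%N).
Proof.
move=> l0 [uI uF] ul; split=> // j _.
have jl : (j %% l < l)%N by rewrite ltn_mod.
(* At a wrap the index returns to 0 where the chain condition speaks of [l]; closedness of the loop
   identifies the two. *)
have := uF _ jl; rewrite modnS; case: ifPn => // /dvdnP[c jc] {uI uF}.
have -> : ((j %% l).+1 = l)%N; last by rewrite ul.
case: c jc => // c jc; have -> : (j = c * l + l.-1)%N by rewrite mulSn in jc; lia.
by rewrite modnMDl modn_small; lia.
Qed.

(* The two loops through [x] and [y] become comparable after repeating each of
   them as many times as the other one is long. *)
Lemma reach_close eta rho a n x y p q :
  (forall L c d, chain eta L c -> chain eta L d ->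
    c 0%N = c L -> d 0%N = c 0%N -> d L = c 0%N ->
    forall i, (i < L)%N -> `|c i - d i| < rho) ->
  (0 < p)%N -> (0 < q)%N ->
  reach eta n a x -> reach eta p x a -> reach eta n a y -> reach eta q y a ->
  `|x - y| < rho.
Proof.
move=> close p0 q0 ax xa ay ya.
have [u [uc u0 un ul]] := reach_trans ax xa.
have [v [vc v0 vn vl]] := reach_trans ay ya.
have lp : (0 < n + p)%N by lia.
have lq : (0 < n + q)%N by lia.
have ul0 : u 0%N = u (n + p)%N by rewrite u0 ul.
have vl0 : v 0%N = v (n + q)%N by rewrite v0 vl.
have := close ((n + p) * (n + q))%N _ _
  (chain_repeat _ lp uc ul0) (chain_repeat _ lq vc vl0).
rewrite /= !mod0n modnMr modnMl u0 v0 => /(_ erefl erefl erefl n).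
rewrite !modn_small ?un ?vn; try lia.
by apply; apply: (@leq_trans (n + p)); [lia|exact: leq_pmulr].
Qed.

Definition chain_recurrent a := I01 a /\
  forall eta, 0 < eta -> exists2 n, (0 < n)%N & reach eta n a a.

(** Induction on [k]: take a return chain from the [k]-th iterate, drop its first step and start
    instead at the true image, which is close. An extra loop at [a] is appended beforehand so that
    the shortened chain is not empty. *)
Lemma chain_recurrent_return a k eta : chain_recurrent a -> 0 < eta ->
  exists2 n, (0 < n)%N & reach eta n (iter k F a) a.
Proof.
move=> [aI aa]; elim: k eta => [|k IH] eta eta0; first exact: aa.
have eta30 : 0 < eta / 3 by lra.
have [r [r0 re Fr]] := uniform_modulus eta30.
have [n n0 xa] := IH _ r0; have [m m0 aar] := aa _ r0.
have [u [[uI uF] u0 un ul]] := reach_trans xa aar.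
exists (n + m).-1%N; first lia.
have -> : eta = eta / 3 + 2 * (eta / 3) by lra.
apply: (@reach_perturb _ _ _ (u 1%N) a) => //; [lia|exact: FI| | |].
- have uF0 := uF 0%N; rewrite u0 in uF0.
  by rewrite /= distrC; apply: Fr; apply: uF0; lia.
- by rewrite subrr normr0.
- exists (fun j => u j.+1); split=> //; last by rewrite prednK ?ul//; lia.
  by split=> // j jn; apply: lt_le_trans (uF _ _) re; lia.
Qed.

(** Otherwise there are points on ever finer loops that stay [rho] away from chain recurrence. They
    accumulate at some [a], and moving the ends of their loops to [a] makes [a] chain recurrent. *)
Lemma near_chain_recurrent rho : 0 < rho -> exists2 e, 0 < e &
  forall y n, (0 < n)%N -> reach e n y y ->
    exists2 a, chain_recurrent a & `|y - a| < rho.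
Proof.
move=> rho0; apply: contrapT => H.
have /choice[y yP] : forall k : nat, exists y,
    (exists2 n, (0 < n)%N & reach k.+1%:R^-1 n y y) /\
    forall a, chain_recurrent a -> ~ `|y - a| < rho.
  move=> k; apply: contrapT => Hk; apply: H; exists k.+1%:R^-1; first by rewrite invr_gt0.
  move=> y n n0 yy; apply: contrapT => Hy; apply: Hk; exists y; split; first by exists n.
  by move=> a ar ya; apply: Hy; exists a.
have yI k : I01 (y k) by have [[n _ [u [[uI _] <- _]]] _] := yP k.
have [a aI ca] := I01_cluster yI.
have ar : chain_recurrent a.
  split=> // eta eta0; have eta30 : 0 < eta / 3 by lra.
  have [r [r0 re Fr]] := uniform_modulus eta30.
  have [N _ HN] := near_infty_natSinv_lt (PosNum eta30).
  have [m Nm yma] := ca _ r0 N; have [[n n0 yy] _] := yP m.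
  exists n => //; have -> : eta = eta / 3 + 2 * (eta / 3) by lra.
  apply: (@reach_perturb _ _ _ (y m) (y m)) => //.
  - by rewrite distrC; apply: Fr.
  - by rewrite distrC; apply: lt_le_trans re.
  - by apply: reach_le yy; apply: ltW; apply: HN.
by have [m _ yma] := ca _ rho0 0%N; have [_ /(_ a ar)] := yP m.
Qed.

Lemma chain_segment e (Y : nat -> R) n m : (n <= m)%N -> (forall j, I01 (Y j)) ->
  (forall j, `|Y j.+1 - F (Y j)| < e) -> reach e (m - n) (Y n) (Y m).
Proof.
move=> nm YI YF; exists (fun j => Y (n + j)%N).
by split; [split=> // j _; rewrite addnS|rewrite addn0|rewrite subnKC].
Qed.

Lemma stable_shadowing :
  (forall eps, 0 < eps -> exists2 delta, 0 < delta & stable_at eps delta) ->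
  forall eps, 0 < eps -> exists2 e, 0 < e & forall Y : nat -> R,
    (forall n, I01 (Y n)) -> (forall n, `|Y n.+1 - F (Y n)| < e) ->
    exists p T N, [/\ I01 p, (0 < T)%N, iter T F p = p &
      forall n, (N <= n)%N -> `|Y n - iter n F p| < eps].
Proof.
(* Four fifths go to the distance from [Y] to the orbit of [a], one fifth to that from this orbit to
   the periodic one. *)
move=> st eps eps0; have e00 : 0 < eps / 5 by lra.
have [delta delta0 std] := st _ e00.
have [eta eta0 close] := loops_close e00 delta0 std.
have eta30 : 0 < eta / 3 by lra.
have [r [r0 re Fr]] := uniform_modulus eta30.
have r20 : 0 < r / 2 by lra.
have [e1 e10 near] := near_chain_recurrent r20.
(* The slack up to [e1] and [eta] pays for moving the ends of pieces of [Y] to [y] and to [a]. *)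
exists (Num.min (e1 / 2) (eta / 3)) => [|Y YI YF].
  by rewrite lt_min; apply/andP; split; lra.
have YF1 j : `|Y j.+1 - F (Y j)| < e1 / 2 by have := YF j; rewrite lt_min => /andP[].
have YF2 j : `|Y j.+1 - F (Y j)| < eta / 3 by have := YF j; rewrite lt_min => /andP[].
have [y yI cy] := I01_cluster YI.
have [a acr ya] : exists2 a, chain_recurrent a & `|y - a| < r / 2.
  have e140 : 0 < e1 / 4 by lra.
  have [r2 [r20' re2 Fr2]] := uniform_modulus e140.
  have [n1 _ h1] := cy _ r20' 0%N; have [n2 n12 h2] := cy _ r20' n1.+1.
  apply: (near y (n2 - n1)%N); first by rewrite subn_gt0.
  have -> : e1 = e1 / 2 + 2 * (e1 / 4) by lra.
  apply: (@reach_perturb _ _ _ (Y n1) (Y n2)) => //; first by rewrite subn_gt0.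
  - by rewrite distrC; apply: Fr2.
  - by rewrite distrC; apply: lt_le_trans re2.
  - by apply: chain_segment => //; exact: ltnW.
have aI := acr.1.
have close_a m : `|Y m - y| < r / 2 -> `|a - Y m| < r.
  by have := ler_distD y (Y m) a; rewrite (distrC a); lra.
have etaE : eta = eta / 3 + 2 * (eta / 3) by lra.
have [N1 _ /close_a aN1] := cy _ r20 0%N.
(* Both points are reached from [a] in [n - N1] steps and lead back to [a]: [Y] by a later visit
   near [a], the true orbit by chain recurrence. *)
have Ya n : (N1 < n)%N -> `|Y n - iter (n - N1) F a| < 4 * (eps / 5).
  move=> N1n.
  have [m nm /close_a am] := cy _ r20 n.+1.
  have [q q0 ret] := chain_recurrent_return (n - N1)%N acr eta0.
  have mn0 : (0 < m - n)%N by rewrite subn_gt0.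
  apply: (reach_close close mn0 q0 (n := (n - N1)%N) _ _ _ ret).
  - rewrite {1}etaE; apply: (@reach_perturb _ _ _ (Y N1) (Y n)) => //.
    + by rewrite subn_gt0.
    + exact: Fr.
    + by rewrite subrr normr0.
    + by apply: chain_segment => //; exact: ltnW.
  - rewrite {1}etaE; apply: (@reach_perturb _ _ _ (Y n) (Y m)) => //.
    + by rewrite subrr normr0.
    + exact: lt_le_trans am re.
    + by apply: chain_segment => //; exact: ltnW.
  - exact: reach_iter.
have [x|p [T [N2 [pI T0 Tp Np]]]] := std F Fc FI _ a aI.
  by rewrite subrr normr0 ltW.
have iterT c : iter (c * T) F p = p.
  by elim: c => // c IH; rewrite mulSn iterD IH.
(* The orbit of [a] is compared with [Y] with a delay of [N1]. This point of the cycle reaches [p]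
   after [N1] steps, which restores the phase. *)
exists (iter (N1 * T - N1) F p), T, (N1 + N2).+1; split=> //.
- exact: iter_I01.
- by rewrite -iterD addnC iterD Tp.
- move=> n nN.
  have N1T : (N1 <= N1 * T)%N by exact: leq_pmulr.
  have N1n : (N1 < n)%N by move: nN; clear; lia.
  have N2n : (N2 <= n - N1)%N by move: nN; clear; lia.
  have -> : iter n F (iter (N1 * T - N1) F p) = iter (n - N1) F p.
    rewrite -iterD; have -> : (n + (N1 * T - N1) = (n - N1) + N1 * T)%N.
      by move: N1T N1n; clear; lia.
    by rewrite iterD iterT.
  have := ler_distD (iter (n - N1) F a) (Y n) (iter (n - N1) F p).
  have := Ya n N1n; have := Np _ N2n; clear; lra.
Qed.
End Shadowing.

(** * Transfer of stability to the extended map *)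

Section Extension.
Variable R : realType.
Implicit Types f : R -> R.

Lemma extend_I01 f x : cont_self_map f -> I01 (extend f x).
Proof. by move=> [fI _]; apply: fI; exact: clamp01_itv. Qed.

Lemma extend_unif_continuous f : cont_self_map f ->
  forall e, 0 < e -> exists2 r, 0 < r &
    forall x y, `|x - y| < r -> `|extend f x - extend f y| < e.
Proof.
move=> [fI fc] e e0.
have [r r0 fr] := unif_continuous_I01 (extend_continuous fc) e0.
exists r => // x y xy.
have := fr _ _ (clamp01_itv x) (clamp01_itv y) (le_lt_trans (clamp01_lip x y) xy).
by rewrite /extend !(clamp01_id (clamp01_itv _)).
Qed.

Lemma extend_id f x : I01 x -> extend f x = f x.
Proof. by move=> xI; rewrite /extend clamp01_id. Qed.

Lemma iter_extend f n x : cont_self_map f -> I01 x ->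
  iter n (extend f) x = iter n f x /\ I01 (iter n f x).
Proof.
move=> [fI _] xI; elim: n => //= n [-> IH]; rewrite extend_id//.
by split=> //; exact: fI.
Qed.

Lemma nonchaotic_stable_extend f : cont_self_map f -> nonchaotic_stable f ->
  forall eps, 0 < eps -> exists2 delta, 0 < delta & stable_at (extend f) eps delta.
Proof.
move=> fc fs eps eps0; have [delta [delta0 H]] := fs _ eps0.
(* Halving turns the non-strict pointwise bound into a strict bound on the supremum. *)
exists (delta / 2); first lra.
move=> g gc gI fg x xI.
have gcs : cont_self_map g by split=> [y _|]; [exact: gI|exact: continuous_subspaceT].
have [|p [[pI [T [T0 Tp]]] /limsupR_lt_near[N HN]]] := H g gcs _ x xI.
  apply: (@le_lt_trans _ _ (delta / 2)); last lra.
  apply: ge_sup.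
    by exists `|f 0 - g 0|, 0 => //; apply/I01E; rewrite lexx ler01.
  by move=> _ [y yI <-]; rewrite -(extend_id f yI).
by exists p, T, N.
Qed.
End Extension.

(** * The almost sure noise bound and the conclusion for random processes *)

Lemma uniform_on_ae_le (d : measure_display) (Omega : measurableType d) (R : realType)
    (P : probability Omega R) (X : Omega -> R) (delta : R) :
  measurable_fun setT X -> uniform_on P X (- delta) delta ->
  {ae P, forall w, `|X w| <= delta}.
Proof.
move=> mX uX; exists (X @^-1` (~` `[- delta, delta])); split.
- by rewrite -[X in measurable X]setTI; apply: mX => //; exact: measurableC.
- rewrite /= uX; last exact: measurableC.
  by rewrite setICl measure0 mule0.
- by move=> w /= Xw; rewrite in_itv/= -ler_norml.
Qed.

Theorem theorem5 (R : realType) (d : measure_display) (Omega : measurableType d)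
    (P : probability Omega R) (fs : nat -> R -> R) (f : R -> R) :
  (forall n, cont_self_map (fs n)) ->
  cont_self_map f ->
  unif_conv_I fs f ->
  nonchaotic_stable f ->
  nonchaotic_random P fs f.
Proof.
move=> fsc fc fsf st eps eps0.
have eps30 : 0 < eps / 3 by lra.
have [e e0 shadow] := stable_shadowing (fun x => extend_I01 x fc)
  (extend_continuous fc.2) (extend_unif_continuous fc)
  (nonchaotic_stable_extend fc st) eps30.
have e20 : 0 < e / 2 by lra.
have [K HK] := fsf _ e20.
(* The chain error [e] is shared between the noise and the distance from [fs] to [f]. Clamping moves
   the process by at most twice the noise, hence [eps / 6]. *)
exists K, (Num.min (e / 2) (eps / 6)); split; first by rewrite lt_min e20; lra.
move=> k Kk delta' _; rewrite lt_min => /andP[d_e d_eps] x0 x0I xi [[mxi _] uxi].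
have : {ae P, forall w, forall n, `|xi n w| <= delta'}.
  by apply: ae_foralln => n; exact: uniform_on_ae_le.
apply: filterS => w xiw.
pose X := process (fun m => fs (k + m)%N) xi x0 ^~ w.
(* The extended maps see only the clamped position, so [Y] carries all the dynamics and stays in
   I. *)
pose Y n := clamp01 (X n).
have YI n : I01 (Y n) by exact: clamp01_itv.
have XS n : X n.+1 = fs (k + n)%N (Y n) + xi n w by [].
have vI n : I01 (fs (k + n)%N (Y n)) by apply: (fsc _).1.
have YF n : `|Y n.+1 - extend f (Y n)| < e.
  rewrite extend_id// -(clamp01_id (fc.1 _ (YI n))).
  apply: le_lt_trans (clamp01_lip _ _) _.
  have h1 : `|fs (k + n)%N (Y n) - f (Y n)| < e / 2.
    by apply: HK => //; apply: leq_trans (ltnW Kk) (leq_addr _ _).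
  rewrite XS addrAC; apply: le_lt_trans (ler_normD _ _) _.
  have := xiw n; lra.
have XY n : `|X n.+1 - Y n.+1| <= eps / 3.
  have := ler_distD (fs (k + n)%N (Y n)) (X n.+1) (Y n.+1).
  have h1 : `|fs (k + n)%N (Y n) - Y n.+1| <= `|xi n w|.
    rewrite -{1}(clamp01_id (vI n)); apply: le_trans (clamp01_lip _ _) _.
    by rewrite XS opprD addrA subrr sub0r normrN.
  have h2 : `|X n.+1 - fs (k + n)%N (Y n)| <= `|xi n w| by rewrite XS addrAC subrr add0r.
  have := xiw n; lra.
have [p [T [N [pI T0 Tp Np]]]] := shadow Y YI YF.
exists p; split.
  by split=> //; exists T; rewrite -(iter_extend T fc pI).1.
(* Eventual bounds give only a non-strict limsup bound; the remaining third of [eps] makes it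
   strict. *)
apply: (@le_lt_trans _ _ (2 * (eps / 3))%:E); last by rewrite lte_fin; lra.
apply: (@limsupR_le _ _ _ N.+1) => -[//|n] nN.
rewrite -(iter_extend n.+1 fc pI).1 -/(X n.+1).
have := Np _ (ltnW nN); have := XY n.
have := ler_distD (Y n.+1) (X n.+1) (iter n.+1 (extend f) p); lra.
Qed.
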